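(* Let $q$ be a prime power and $n\geq 2$, let $e=(q^n-1)/(q-1)$ and $f=q-1$ (so $q^n=ef+1$), let $\alpha$ be a primitive element of $\mathrm{GF}(q^n)$, and let $\epsilon$ be a positive integer with $\epsilon\mid e$. Then: (i) $$(0,0)_{\epsilon}=(f-1)+\sum_{s=1}^{\frac{e}{\epsilon}-1}\ \sum_{\substack{r\equiv 0 \bmod \epsilon,\\ 1\leq r\leq e-1}}(r,\epsilon s)_e .$$ (ii) For all $0<i<\epsilon$, $$(i,0)_{\epsilon}=(0,i)_{\epsilon}=(e-i,e-i)_{\epsilon}=\sum_{s=1}^{\frac{e}{\epsilon}-1}\ \sum_{\substack{r\equiv i \bmod \epsilon,\\ 1\leq r\leq e-1}}(r,\epsilon s)_e .$$ (iii) For $0<i\neq j<\epsilon$ (i.e. $0<i,j<\epsilon$ with $i\neq j$), $$(i,j)_{\epsilon}=\sum_{s=0}^{\frac{e}{\epsilon}-1}\ \sum_{\substack{r\equiv i \bmod \epsilon,\\ 1\leq r\leq e-1}}(r,\epsilon s+j)_e .$$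
   Context: For any positive divisor $m$ of $q^n-1$, the cyclotomic classes of order $m$ in $\mathrm{GF}(q^n)$ are $C_i^m=\{\alpha^{ms+i}:0\leq s\leq \frac{q^n-1}{m}-1\}$, $0\leq i\leq m-1$, and the cyclotomic number $(i,j)_m$ is the number of pairs $(z_i,z_j)\in C_i^m\times C_j^m$ with $z_i=z_j-1$; the indices $i,j$ in $(i,j)_m$ are read modulo $m$. All cyclotomic numbers are with respect to the same primitive element $\alpha$. *)

(* Defs.v *)
From mathcomp Require Import all_boot all_order all_algebra all_field.

Set Implicit Arguments.
Unset Strict Implicit.
Unset Printing Implicit Defensive.

Definition prime_power (q : nat) : Prop :=
  exists p k : nat, [/\ prime p, 0 < k & q = p ^ k].

Definition primitive_element (F : finFieldType) (alpha : F) : bool :=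
  ((#|F| - 1)%N.-primitive_root alpha)%R.

(* Meant for i < m with m %| #|F| - 1; indices are reduced modulo m only in
   [cyc_num]. *)
Definition cyc_class (F : finFieldType) (alpha : F) (m i : nat) : {set F} :=
  [set (alpha ^+ (m * s + i))%R | s : 'I_((#|F| - 1) %/ m)].

Definition cyc_num (F : finFieldType) (alpha : F) (m i j : nat) : nat :=
  #|[set z : F * F | [&& z.1 \in cyc_class alpha m (i %% m),
                         z.2 \in cyc_class alpha m (j %% m)
                       & z.1 == (z.2 - 1)%R]]|.

(* Main.v *)
Require Import Defs.
From mathcomp Require Import all_boot all_order all_algebra all_field.

(** Two facts combine.

    Refinement: when [d] divides [m], a cyclotomic class of order [d] is the
    disjoint union of the classes of order [m] whose index lies in a fixed
    residue class modulo [d].  Counting the pairs in question class by class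
    turns every cyclotomic number of order [d] into a double sum of cyclotomic
    numbers of order [m] ([cyc_num_refine]).  With [d = eps] and [m = e] this
    is already part (iii).

    Subfield: for [e = (q^n - 1) / (q - 1)] the class of index 0 is the set of
    solutions of [x ^ (q - 1) = 1], the multiplicative group of GF(q).  Since
    GF(q) is closed under adding and subtracting 1, the numbers [(r, 0)_e] and
    [(0, r)_e] vanish for [0 < r < e], whereas [(0, 0)_e] counts the elements
    of GF(q) other than 0 and 1, so it equals [q - 2].  Substituting these
    values in the refined sums gives (i) and the last expression in (ii).

    The other equalities in (ii) are the classical symmetries of cyclotomic
    numbers: [x |-> 1 - x] exchanges the two indices, because [-1] lies in
    GF(q) and hence in every class of index 0 involved ([cyc_numC]), and
    [x |-> x / (x - 1)] sends [(i, j)] to [(-i, j - i)] ([cyc_numV]). *)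

Set Implicit Arguments.
Unset Strict Implicit.
Unset Printing Implicit Defensive.

Import GRing.Theory.

(** * Sums over residue classes *)

(** Truth values as numbers: every residue has exactly one representative in
    the range, so only one term survives. *)
Lemma sum_residue_class (m d i a : nat) : 0 < m -> d %| m ->
  \sum_(0 <= r < m | r == i %[mod d]) (a == r %[mod m] : nat)
    = (a == i %[mod d]).
Proof.
move=> m_gt0 dm; rewrite big_mkord big_mkcond /=.
rewrite (bigD1 (Ordinal (ltn_pmod a m_gt0))) //= modn_mod eqxx.
rewrite modn_dvdm // big1 ?addn0; first by case: ifP.
move=> r /eqP neq_r; case: ifP => // _; rewrite (modn_small (ltn_ord r)).
by case: eqP => // ar; case: neq_r; apply: val_inj.
Qed.

Lemma sum_arith_progression (m d j a : nat) : 0 < m -> d %| m -> j < d ->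
  \sum_(0 <= s < m %/ d) (a == d * s + j %[mod m] : nat) = (a == j %[mod d]).
Proof.
move=> m_gt0 dm jd; have d_gt0 : 0 < d by apply: leq_ltn_trans jd.
have lt_s : a %% m %/ d < m %/ d.
  by rewrite ltn_divLR // divnK // ltn_pmod.
have small s : s < m %/ d -> d * s + j < m.
  move=> lts; apply: (@leq_trans (d * s.+1)).
    by rewrite mulnS addnC ltn_add2r.
  by rewrite mulnC -leq_divRL.
rewrite big_mkord (bigD1 (Ordinal lt_s)) //= big1 ?addn0.
  rewrite (modn_small (small _ lt_s)) {1}(divn_eq (a %% m) d) mulnC.
  by rewrite eqn_add2l modn_dvdm // (modn_small jd).
move=> s /eqP neq_s; case: eqP => // as_; case: neq_s; apply: val_inj => /=.
rewrite as_ (modn_small (small _ (ltn_ord s))) mulnC divnMDl //.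
by rewrite (divn_small jd) addn0.
Qed.

(** * Discrete logarithms and cyclotomic classes *)

Section Cyclotomy.

Variables (F : finFieldType) (alpha : F).
Hypothesis alpha_prim : primitive_element alpha.

Local Notation N := (#|F| - 1).
Local Notation C m i := (cyc_class alpha m (i %% m)).

Lemma alpha_neq0 : (alpha != 0)%R.
Proof.
by rewrite (prim_root_eq0 alpha_prim) -lt0n (prim_order_gt0 alpha_prim).
Qed.

Definition dlog (x : F) : nat :=
  if [pick k : 'I_N | alpha ^+ k == x]%R is Some k then k : nat else 0.

(** The [N] nonzero elements are [N]-th roots of unity, and these are all
    powers of the primitive root. *)
Lemma expr_dlog (x : F) : (x != 0)%R -> (alpha ^+ dlog x = x)%R.
Proof.
move=> x0; rewrite /dlog; case: pickP => [k /eqP // | none].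
have xN : (x ^+ N = 1)%R.
  apply: (mulfI x0); rewrite -exprS subn1 prednK ?expf_card ?mulr1 //.
  by rewrite (cardD1 0%R).
by have [k xk] := prim_rootP alpha_prim xN; have := none k; rewrite -xk eqxx.
Qed.

Lemma eq_dlog_mod (m k i : nat) : m %| N ->
  (dlog (alpha ^+ k)%R == i %[mod m]) = (k == i %[mod m]).
Proof.
move=> mN; rewrite -(modn_dvdm (dlog _) mN) -(modn_dvdm k mN).
have /eqP := expr_dlog (expf_neq0 k alpha_neq0).
by rewrite (eq_prim_root_expr alpha_prim) => /eqP->.
Qed.

Lemma mem_cyc_class_expr (m i k : nat) : m %| N ->
  (alpha ^+ k \in C m i)%R = (k == i %[mod m]).
Proof.
move=> mN; have N_gt0 := prim_order_gt0 alpha_prim.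
have m_gt0 : 0 < m by apply: dvdn_gt0 mN.
apply/imsetP/eqP => [[s _ /eqP] | ki].
  rewrite (eq_prim_root_expr alpha_prim) => /eqP ks.
  by rewrite -(modn_dvdm k mN) ks modn_dvdm // mulnC modnMDl modn_mod.
have lt_s : k %% N %/ m < N %/ m by rewrite ltn_divLR // divnK // ltn_pmod.
exists (Ordinal lt_s) => //=.
rewrite -ki -(modn_dvdm k mN) mulnC -divn_eq.
by rewrite prim_expr_mod.
Qed.

Lemma mem_cyc_class (m i : nat) (x : F) : m %| N ->
  (x \in C m i) = (x != 0)%R && (dlog x == i %[mod m]).
Proof.
move=> mN; case: eqP => [-> | /eqP x0] /=.
  apply/imsetP => -[s _ /eqP]; apply/negP.
  by rewrite eq_sym expf_neq0 ?alpha_neq0.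
by rewrite -{1}(expr_dlog x0) mem_cyc_class_expr.
Qed.

Lemma mem0_cyc_class (m i : nat) : m %| N -> (0 \in C m i)%R = false.
Proof. by move=> mN; rewrite mem_cyc_class // eqxx. Qed.

Lemma mem_cyc_class_mull (m i : nat) (c x : F) : m %| N -> (c \in C m 0) ->
  (c * x \in C m i)%R = (x \in C m i).
Proof.
move=> mN; rewrite !mem_cyc_class // mulf_eq0 negb_or => /andP[c0 c_log].
rewrite c0 /=; case: eqP => //= /eqP x0.
rewrite -{1}(expr_dlog c0) -{1}(expr_dlog x0) -exprD eq_dlog_mod //.
by rewrite -modnDml (eqP c_log) mod0n.
Qed.

Lemma card_cyc_class0 (m : nat) : m %| N -> #|C m 0| = N %/ m.
Proof.
move=> mN; have N_gt0 := prim_order_gt0 alpha_prim.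
have m_gt0 : 0 < m by apply: dvdn_gt0 mN.
rewrite card_imset ?card_ord // => s t /eqP.
rewrite (eq_prim_root_expr alpha_prim) mod0n !addn0.
have small (u : 'I_(N %/ m)) : m * u < N.
  by rewrite mulnC -ltn_divRL.
by rewrite !modn_small // eqn_pmul2l // => /eqP/val_inj.
Qed.

(** * Cyclotomic numbers *)

(** A pair is determined by its second component. *)
Lemma cyc_num_sum (m i j : nat) :
  cyc_num alpha m i j =
    \sum_(x : F) ((x - 1 \in C m i)%R * (x \in C m j)).
Proof.
rewrite /cyc_num; have -> : [set z : F * F | [&& z.1 \in C m i, z.2 \in C m j
    & z.1 == (z.2 - 1)%R]] =
  [set (x - 1, x)%R | x in [set x : F | (x - 1 \in C m i)%R && (x \in C m j)]].
  apply/setP => -[y x]; rewrite inE /=; apply/and3P/imsetP.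
    by move=> [yi xj /eqP yx]; exists x; rewrite ?inE -?yx ?yi.
  by move=> [x']; rewrite inE => /andP[? ?] [-> ->].
rewrite card_imset => [| x y [_ //]].
rewrite -sum1_card big_mkcond; apply: eq_bigr => x _ /=.
by rewrite inE; case: (_ \in _); case: (_ \in _).
Qed.

(** Each factor of a summand of [cyc_num_sum] is split separately: the class
    of [x - 1] over the residues [r], and the class of [x] over the indices
    [d * s + j], [s < m / d], which list the residues of [j] in order. *)
Lemma cyc_num_refine (m d i j : nat) : m %| N -> d %| m -> j < d ->
  cyc_num alpha d i j =
    \sum_(0 <= s < m %/ d) \sum_(0 <= r < m | r == i %[mod d])
      cyc_num alpha m r (d * s + j).
Proof.
move=> mN dm jd; have dN := dvdn_trans dm mN.
have m_gt0 : 0 < m by apply: dvdn_gt0 mN; apply: prim_order_gt0 alpha_prim.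
under [RHS]eq_bigr => s _ do under eq_bigr => r _ do rewrite cyc_num_sum.
under [RHS]eq_bigr => s _ do rewrite exchange_big.
rewrite exchange_big cyc_num_sum; apply: eq_bigr => x _ /=.
under [RHS]eq_bigr => s _ do rewrite -big_distrl /=.
rewrite -big_distrr /=; congr (_ * _).
  rewrite mem_cyc_class //; under eq_bigr => r _ do rewrite mem_cyc_class //.
  by case: (x - 1 != 0)%R => /=; [rewrite sum_residue_class | rewrite big1].
rewrite mem_cyc_class //; under eq_bigr => s _ do rewrite mem_cyc_class //.
by case: (x != 0)%R => /=; [rewrite sum_arith_progression | rewrite big1].
Qed.

Lemma cyc_numC (m i j : nat) : m %| N -> (-1 \in C m 0)%R ->
  cyc_num alpha m i j = cyc_num alpha m j i.
Proof.
move=> mN m1; have inv : involutive (fun x : F => 1 - x)%R.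
  by move=> x; rewrite subKr.
rewrite !cyc_num_sum (reindex_inj (inv_inj inv)); apply: eq_bigr => x _ /=.
rewrite addrAC subrr add0r mulnC -(mem_cyc_class_mull i x mN m1).
by rewrite -(mem_cyc_class_mull j (x - 1)%R mN m1) !mulN1r opprB.
Qed.

(** Dividing [x - (x - 1) = 1] by [x - 1] gives
    [x / (x - 1) - 1 = 1 / (x - 1)], so [x / (x - 1)] is the second component
    of another pair.  Since [0^-1 = 0], the map [x |-> 1 + (x - 1)^-1], which
    extends [x |-> x / (x - 1)], is an involution of the whole field. *)
Lemma cyc_numV (m i j i' j' : nat) : m %| N ->
  i + i' == 0 %[mod m] -> j' + i == j %[mod m] ->
  cyc_num alpha m i j = cyc_num alpha m i' j'.
Proof.
move=> mN ii' jij'; have inv : involutive (fun x : F => 1 + (x - 1)^-1)%R.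
  by move=> x; rewrite addrAC subrr add0r invrK addrC subrK.
rewrite !cyc_num_sum [RHS](reindex_inj (inv_inj inv)).
apply: eq_bigr => x _ /=; rewrite addrAC subrr add0r.
rewrite !mem_cyc_class // invr_eq0.
have [|w0] := eqVneq (x - 1)%R 0%R => //=.
have -> : (1 + (x - 1)^-1 = x / (x - 1))%R.
  by rewrite -[X in (X / _)%R](subrK 1 x)%R mulrDl divff // mul1r.
set w := (x - 1)%R in w0 *.
have wV : (dlog w + dlog (w^-1)%R == 0 %[mod m]).
  rewrite -(eq_dlog_mod _ _ mN) exprD !expr_dlog ?invr_eq0 // divff //.
  by rewrite -[1%R](expr0 alpha) eq_dlog_mod.
have -> : (dlog (w^-1)%R == i' %[mod m]) = (dlog w == i %[mod m]).
  rewrite -(eqn_modDl (dlog w)) (eqP wV) -(eqP ii') eqn_modDr.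
  by rewrite eq_sym.
case: (boolP (dlog w == i %[mod m])) => //= wi; congr (_ * _).
rewrite mulf_eq0 invr_eq0 (negPf w0) orbF.
have [|x0] := eqVneq x 0%R => //=.
rewrite -{2}(expr_dlog x0).
rewrite -{1}[(w^-1)%R]expr_dlog ?invr_eq0 // -exprD eq_dlog_mod //.
rewrite -[in RHS](eqn_modDr (dlog w)) -addnA (addnC (dlog (w^-1)%R)).
rewrite -(modnDmr (dlog x)) (eqP wV) mod0n addn0.
by rewrite -(modnDmr j') (eqP wi) modnDmr (eqP jij').
Qed.

(** * The class formed by the nonzero elements of a subfield *)

Section Subfield.

Variables (p k e : nat).
Local Notation q := (p ^ k).
Hypotheses (p_char : p \in [pchar F]%R) (eN : e * (q - 1) = N).

Let e_dvdN : e %| N.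
Proof. by rewrite -eN dvdn_mulr. Qed.

Let q_gt1 : 1 < q.
Proof.
rewrite -subn_gt0; have := prim_order_gt0 alpha_prim.
by rewrite -eN muln_gt0 => /andP[].
Qed.

(** With [x = alpha ^ a], both sides say that [e * (q - 1)], the order of
    [alpha], divides [a * (q - 1)]. *)
Lemma mem_cyc_class0_fixed (x : F) :
  (x \in C e 0) = (x != 0)%R && (x ^+ q == x)%R.
Proof.
rewrite mem_cyc_class //; case: eqP => //= /eqP x0.
rewrite -{2 3}(expr_dlog x0) -exprM.
rewrite (eq_prim_root_expr alpha_prim) -eN mod0n -/(e %| _).
rewrite -(subnKC (ltnW q_gt1)) mulnDr muln1 addKn.
rewrite -[X in _ == X %[mod _]]addn0 eqn_modDl mod0n.
by rewrite -/(_ %| _) dvdn_pmul2r ?subn_gt0.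
Qed.

(** Being fixed by the [q]-th power Frobenius map, which is additive, is
    stable under translation by [1]. *)
Lemma expr_sub1_fixed (x : F) : ((x - 1) ^+ q == x - 1)%R = (x ^+ q == x)%R.
Proof.
have pchar_q : [pchar F]%R.-nat q.
  by rewrite pnatX pnatE ?p_char // (pcharf_prime p_char).
by rewrite exprDn_pchar // exprNn_pchar // expr1n (inj_eq (addIr _)).
Qed.

Lemma sub1_mem_cyc_class0 (x : F) : x != 1%R -> (x \in C e 0) ->
  (x - 1 \in C e 0)%R.
Proof.
move=> x1; rewrite !mem_cyc_class0_fixed => /andP[_].
by rewrite expr_sub1_fixed subr_eq0 x1 => ->.
Qed.

Lemma opp1_mem_cyc_class0 (m : nat) : m %| e -> (-1 \in C m 0)%R.
Proof.
move=> m_e; suff : (-1 \in C e 0)%R.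
  rewrite !mem_cyc_class ?(dvdn_trans m_e) // => /andP[-> /= /eqP log0].
  by rewrite -(modn_dvdm _ m_e) log0 !mod0n.
rewrite mem_cyc_class0_fixed oppr_eq0 oner_neq0 -[(-1)%R]add0r.
by rewrite expr_sub1_fixed expr0n (gtn_eqF (ltnW q_gt1)) eqxx.
Qed.

(** Every element of the class other than 1 contributes a pair, because its
    predecessor is a nonzero element of the subfield. *)
Lemma cyc_num_subfield00 : cyc_num alpha e 0 0 = q - 1 - 1.
Proof.
have e_gt0 : 0 < e by apply: dvdn_gt0 e_dvdN; apply: prim_order_gt0 alpha_prim.
have C1 : (1 \in C e 0)%R by rewrite -(expr0 alpha) mem_cyc_class_expr.
have <- : #|C e 0| = q - 1 by rewrite card_cyc_class0 // -eN mulKn.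
rewrite (cardsD1 1%R (C e 0)) C1 addKn -sum1_card big_mkcond cyc_num_sum.
apply: eq_bigr => x _; rewrite in_setD1.
have [-> | x1] := eqVneq x 1%R; first by rewrite subrr mem0_cyc_class.
case: (boolP (x \in C e 0)) => [xC | _]; last by rewrite muln0.
by rewrite sub1_mem_cyc_class0.
Qed.

Lemma cyc_num_subfield_r0 (r : nat) : 0 < r < e -> cyc_num alpha e r 0 = 0.
Proof.
move=> /andP[r_gt0 lt_re]; rewrite cyc_num_sum big1 // => x _.
case: (boolP (x \in C e 0)) => [xC | _]; last by rewrite muln0.
have [-> | x1] := eqVneq x 1%R; first by rewrite subrr mem0_cyc_class.
have := sub1_mem_cyc_class0 x1 xC; rewrite !mem_cyc_class // => /andP[-> /eqP->].
by rewrite mod0n modn_small // eq_sym (gtn_eqF r_gt0).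
Qed.

Lemma cyc_num_subfield_0r (r : nat) : 0 < r < e -> cyc_num alpha e 0 r = 0.
Proof.
by move=> lt_r; rewrite cyc_numC ?opp1_mem_cyc_class0 ?cyc_num_subfield_r0.
Qed.

End Subfield.

End Cyclotomy.

(** * The cyclotomic numbers of order [eps] *)

Theorem theorem4p2 (q n e f : nat) (F : finFieldType) (alpha : F) (eps : nat)
    (hq : prime_power q) (hn : 2 <= n)
    (he : e = (q ^ n - 1) %/ (q - 1)) (hf : f = q - 1)
    (hF : #|F| = q ^ n)
    (halpha : primitive_element alpha)
    (heps0 : 0 < eps) (heps : eps %| e) :
  [/\ cyc_num alpha eps 0 0 =
        (f - 1) + \sum_(1 <= s < e %/ eps)
                    \sum_(1 <= r < e | r == 0 %[mod eps])
                       cyc_num alpha e r (eps * s),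
      (forall i : nat, 0 < i < eps ->
         [/\ cyc_num alpha eps i 0 = cyc_num alpha eps 0 i,
             cyc_num alpha eps 0 i = cyc_num alpha eps (e - i) (e - i)
           & cyc_num alpha eps (e - i) (e - i) =
               \sum_(1 <= s < e %/ eps)
                 \sum_(1 <= r < e | r == i %[mod eps])
                    cyc_num alpha e r (eps * s)])
    & (forall i j : nat, 0 < i < eps -> 0 < j < eps -> i <> j ->
         cyc_num alpha eps i j =
           \sum_(0 <= s < e %/ eps)
             \sum_(1 <= r < e | r == i %[mod eps])
                cyc_num alpha e r (eps * s + j))].
Proof.
case: hq => p [k [p_prime _ def_q]].
have p_char : p \in [pchar F]%R.
  by apply: (@card_finPcharP _ _ (k * n)); rewrite // hF def_q expnM.
have eN : e * (p ^ k - 1) = #|F| - 1.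
  by rewrite he hF -def_q divnK // !subn1 predn_exp dvdn_mulr.
have eN_dvd : e %| #|F| - 1 by rewrite -eN dvdn_mulr.
have epsN := dvdn_trans heps eN_dvd.
have e_gt0 : 0 < e by apply: dvdn_gt0 eN_dvd; apply: prim_order_gt0 halpha.
have quo_gt0 : 0 < e %/ eps by rewrite divn_gt0 // dvdn_leq.
have r0 r : 0 < r < e -> cyc_num alpha e r 0 = 0.
  exact: (cyc_num_subfield_r0 halpha p_char eN).
have r_0 r : 0 < r < e -> cyc_num alpha e 0 r = 0.
  exact: (cyc_num_subfield_0r halpha p_char eN).
(* For a nonzero residue the index 0 is never selected. *)
have skip0 i (G : nat -> nat) : 0 < i < eps ->
    \sum_(0 <= r < e | r == i %[mod eps]) G r
      = \sum_(1 <= r < e | r == i %[mod eps]) G r.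
  move=> /andP[i_gt0 lt_i]; rewrite [LHS]big_ltn_cond // mod0n modn_small //.
  by rewrite eq_sym gtn_eqF.
have row0 i : \sum_(1 <= r < e | r == i %[mod eps]) cyc_num alpha e r 0 = 0.
  by rewrite big_nat_cond big1 // => r /andP[/r0].
have num_i0 i : 0 < i < eps -> cyc_num alpha eps i 0 =
    \sum_(1 <= s < e %/ eps) \sum_(1 <= r < e | r == i %[mod eps])
      cyc_num alpha e r (eps * s).
  move=> lt_i; rewrite (cyc_num_refine halpha i eN_dvd heps heps0).
  rewrite big_ltn // muln0 skip0 // row0 add0n.
  by apply: eq_bigr => s _; rewrite skip0 // addn0.
have num_V i : 0 < i < eps ->
    cyc_num alpha eps i 0 = cyc_num alpha eps (e - i) (e - i).
  move=> /andP[_ lt_i]; have le_ie := leq_trans (ltnW lt_i) (dvdn_leq e_gt0 heps).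
  by apply: cyc_numV; rewrite ?subnK ?subnKC ?mod0n.
have num_C i : cyc_num alpha eps i 0 = cyc_num alpha eps 0 i.
  apply: cyc_numC => //.
  exact: (opp1_mem_cyc_class0 halpha p_char eN heps).
split=> [|i lt_i|i j lt_i /andP[_ lt_j] _].
- rewrite (cyc_num_refine halpha 0 eN_dvd heps heps0).
  rewrite big_ltn // big_ltn_cond //= eqxx muln0 row0 !addn0.
  rewrite (cyc_num_subfield00 halpha p_char eN) hf def_q; congr (_ + _).
  apply: eq_big_nat => s /andP[s_gt0 lt_s]; rewrite big_ltn_cond //= eqxx !addn0.
  by rewrite r_0 // muln_gt0 heps0 s_gt0 /= mulnC -ltn_divRL.
- by split; rewrite -?num_C -?num_V -?num_i0.
- rewrite (cyc_num_refine halpha i eN_dvd heps lt_j).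
  by apply: eq_bigr => s _; rewrite skip0.
Qed.
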